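(* Let $W=S_n$ and let $\mathbb H_W$ be the odd double affine Hecke algebra of type $A_{n-1}$. For $1\le i\le n$ put $$\mathfrak z_i=-\xi_i\eta_i+u\sum_{k<i}s_{ki}\in\mathbb H_W.$$ Then the elements $\mathfrak z_i$ ($1\le i\le n$) and $S_n$ generate (inside $\mathbb H_W$) the degenerate affine Hecke algebra of type $A$; that is, the subalgebra of $\mathbb H_W$ generated by them is isomorphic, via the evident identification of generators, to the degenerate affine Hecke algebra with parameter $u$.
   Context: All algebras are over $\mathbb C$; $[a,b]_+=ab+ba$. $s_{ij}\in S_n$ is the transposition of $i,j$, and $s_i=s_{i,i+1}$. $S_n$ permutes the indices of the $\xi_j$ and of the $\eta_j$, written $\xi_j\mapsto\xi_j^\sigma$. Let $t,u\in\mathbb C$. The odd double affine Hecke algebra $\mathbb H_W$ of type $A_{n-1}$ is generated by $\xi_i,\eta_i$ ($1\le i\le n$) and $\mathbb C S_n$ subject to: $\eta_i\eta_j=-\eta_j\eta_i$, $\xi_i\xi_j=-\xi_j\xi_i$ ($i\ne j$); $\sigma\xi_j=\xi_j^\sigma\sigma$, $\sigma\eta_j=\eta_j^\sigma\sigma$ ($\sigma\in S_n$); $[\eta_i,\xi_j]_+=us_{ij}$ ($i\ne j$); $[\eta_i,\xi_i]_+=t+u\sum_{k\ne i}s_{ki}$. The degenerate affine Hecke algebra of type $A$ (Drinfeld, Lusztig) with parameter $u$ is the algebra generated by $\mathbb C S_n$ and commuting elements $z_1,\dots,z_n$ subject to $s_iz_i=z_{i+1}s_i-u$ ($1\le i\le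 n-1$) and $s_iz_j=z_js_i$ for $j\ne i,i+1$. *)

(* Defs.v *)
From HB Require Import structures.
From mathcomp Require Export all_boot all_order all_algebra fingroup perm.
From mathcomp Require Export boolp classical_sets reals.
From mathcomp Require Export complex.

Set Implicit Arguments.
Unset Strict Implicit.
Unset Printing Implicit Defensive.

Import GRing.Theory.
Local Open Scope ring_scope.
Local Open Scope quotient_scope.

Local Notation repr := generic_quotient.repr.

(* K-algebras given by generators and relations: noncommutative polynomial    *)
(* expressions in the generators, modulo the least congruence that contains   *)
(* the relations and the axioms of unital associative K-algebras.             *)

Inductive expr (K X : Type) : Type :=
| EGen of X
| EZero
| EOne
| EOpp of expr K X
| EAdd of expr K X & expr K X
| EMul of expr K X & expr K X
| EScale of K & expr K X.

Arguments EGen {K X}.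
Arguments EZero {K X}.
Arguments EOne {K X}.

Declare Scope expr_scope.
Delimit Scope expr_scope with expr.
Bind Scope expr_scope with expr.
Notation "0" := EZero : expr_scope.
Notation "1" := EOne : expr_scope.
Notation "- x" := (EOpp x) : expr_scope.
Notation "x + y" := (EAdd x y) : expr_scope.
Notation "x - y" := (EAdd x (EOpp y)) : expr_scope.
Notation "x * y" := (EMul x y) : expr_scope.
Notation "a *: x" := (EScale a x) : expr_scope.
Notation "\sum_ ( i | P ) F" := (\big[@EAdd _ _/EZero]_(i | P%B) F%expr)
  : expr_scope.

Section Presentation.

Variables (K : comPzRingType) (X : Type) (E : expr K X -> expr K X -> Prop).

Inductive expr_cong : expr K X -> expr K X -> Prop :=
| cong_rel x y : E x y -> expr_cong x y
| cong_refl x : expr_cong x x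
| cong_sym x y : expr_cong x y -> expr_cong y x
| cong_trans y x z : expr_cong x y -> expr_cong y z -> expr_cong x z
| cong_opp x x' : expr_cong x x' -> expr_cong (- x) (- x')
| cong_add x x' y y' :
    expr_cong x x' -> expr_cong y y' -> expr_cong (x + y) (x' + y')
| cong_mul x x' y y' :
    expr_cong x x' -> expr_cong y y' -> expr_cong (x * y) (x' * y')
| cong_scale a x x' : expr_cong x x' -> expr_cong (a *: x) (a *: x')
| cong_addA x y z : expr_cong (x + (y + z)) (x + y + z)
| cong_addC x y : expr_cong (x + y) (y + x)
| cong_add0 x : expr_cong (0 + x) x
| cong_addN x : expr_cong (- x + x) 0
| cong_mulA x y z : expr_cong (x * (y * z)) (x * y * z)
| cong_mul1l x : expr_cong (1 * x) x
| cong_mul1r x : expr_cong (x * 1) x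
| cong_mulDl x y z : expr_cong ((x + y) * z) (x * z + y * z)
| cong_mulDr x y z : expr_cong (x * (y + z)) (x * y + x * z)
| cong_scaleA a b x : expr_cong (a *: (b *: x)) ((a * b)%R *: x)
| cong_scale1 x : expr_cong (1%R *: x) x
| cong_scaleDr a x y : expr_cong (a *: (x + y)) (a *: x + a *: y)
| cong_scaleDl a b x : expr_cong ((a + b)%R *: x) (a *: x + b *: x)
| cong_scaleAl a x y : expr_cong (a *: (x * y)) (a *: x * y)
| cong_scaleAr a x y : expr_cong (a *: (x * y)) (x * (a *: y)).

HB.instance Definition _ := gen_eqMixin (expr K X).
HB.instance Definition _ := gen_choiceMixin (expr K X).

Definition expr_eqv : rel (expr K X) := fun x y => `[< expr_cong x y >].

Lemma expr_eqv_class : equiv_class_of expr_eqv.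
Proof.
split.
- by move=> x; apply/asboolP; exact: cong_refl.
- by move=> x y; apply/asboolP/asboolP; exact: cong_sym.
- move=> y x z /asboolP xy /asboolP yz; apply/asboolP; exact: cong_trans xy yz.
Qed.

Canonical expr_eqv_equiv := EquivRelPack expr_eqv_class.

Definition presented := {eq_quot expr_eqv}.

HB.instance Definition _ := Choice.on presented.
HB.instance Definition _ := EqQuotient.on presented.

Definition pclass (x : expr K X) : presented := \pi_presented x.

Lemma pclassP x y : pclass x = pclass y <-> expr_cong x y.
Proof.
split=> [/eqquotP /asboolP //|xy].
by apply/eqquotP; apply/asboolP.
Qed.

Lemma pclassK x : pclass (repr x) = x.
Proof. exact: reprK. Qed.

Lemma repr_pclass x : expr_cong (repr (pclass x)) x.
Proof. by apply/pclassP; rewrite pclassK. Qed.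

Definition pgen (x : X) : presented := pclass (EGen x).
Definition popp (x : presented) := pclass (- repr x).
Definition padd (x y : presented) := pclass (repr x + repr y).
Definition pmul (x y : presented) := pclass (repr x * repr y).
Definition pscale (a : K) (x : presented) := pclass (a *: repr x).

Lemma pclass_opp x : popp (pclass x) = pclass (- x).
Proof. by apply/pclassP/cong_opp/repr_pclass. Qed.
Lemma pclass_add x y : padd (pclass x) (pclass y) = pclass (x + y).
Proof. by apply/pclassP/cong_add; apply: repr_pclass. Qed.
Lemma pclass_mul x y : pmul (pclass x) (pclass y) = pclass (x * y).
Proof. by apply/pclassP/cong_mul; apply: repr_pclass. Qed.
Lemma pclass_scale a x : pscale a (pclass x) = pclass (a *: x).
Proof. by apply/pclassP/cong_scale/repr_pclass. Qed.

Lemma presented_ind (P : presented -> Prop) :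
  (forall x, P (pclass x)) -> forall x, P x.
Proof. by move=> Px x; rewrite -(pclassK x). Qed.

Definition pclassE := (pclass_opp, pclass_add, pclass_mul, pclass_scale).

Ltac presented_axiom c :=
  repeat (let x := fresh in elim/presented_ind => x || move=> x);
  rewrite ?pclassE; apply/pclassP; exact: c.

Lemma paddA : associative padd. Proof. presented_axiom cong_addA. Qed.
Lemma paddC : commutative padd. Proof. presented_axiom cong_addC. Qed.
Lemma padd0 : left_id (pclass 0) padd. Proof. presented_axiom cong_add0. Qed.
Lemma paddN : left_inverse (pclass 0) popp padd.
Proof. presented_axiom cong_addN. Qed.

HB.instance Definition _ :=
  GRing.isZmodule.Build presented paddA paddC padd0 paddN.

Lemma pmulA : associative pmul. Proof. presented_axiom cong_mulA. Qed.
Lemma pmul1l : left_id (pclass 1) pmul. Proof. presented_axiom cong_mul1l. Qed.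
Lemma pmul1r : right_id (pclass 1) pmul. Proof. presented_axiom cong_mul1r. Qed.
Lemma pmulDl : left_distributive pmul padd.
Proof. presented_axiom cong_mulDl. Qed.
Lemma pmulDr : right_distributive pmul padd.
Proof. presented_axiom cong_mulDr. Qed.

(* Nothing prevents 1 = 0 in an algebra given by arbitrary relations, so      *)
(* [algType K] is not available here: the algebra structure is split between  *)
(* [pzRingType], [lmodType K], [presented_scalerAl] and [presented_scalerAr]. *)
HB.instance Definition _ :=
  GRing.Zmodule_isPzRing.Build presented pmulA pmul1l pmul1r pmulDl pmulDr.

Lemma pscaleA a b x : pscale a (pscale b x) = pscale (a * b) x.
Proof. move: a b x; presented_axiom cong_scaleA. Qed.
Lemma pscale1 : left_id 1 pscale. Proof. presented_axiom cong_scale1. Qed.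
Lemma pscaleDr : right_distributive pscale padd.
Proof. presented_axiom cong_scaleDr. Qed.
Lemma pscaleDl x a b : pscale (a + b) x = padd (pscale a x) (pscale b x).
Proof. move: x a b; presented_axiom cong_scaleDl. Qed.

HB.instance Definition _ :=
  GRing.Zmodule_isLmodule.Build K presented pscaleA pscale1 pscaleDr pscaleDl.

Lemma presented_scalerAl (a : K) (x y : presented) : a *: (x * y) = a *: x * y.
Proof.
rewrite -[LHS]/(pscale a (pmul x y)) -[RHS]/(pmul (pscale a x) y).
move: a x y; presented_axiom cong_scaleAl.
Qed.
Lemma presented_scalerAr (a : K) (x y : presented) : a *: (x * y) = x * (a *: y).
Proof.
rewrite -[LHS]/(pscale a (pmul x y)) -[RHS]/(pmul x (pscale a y)).
move: a x y; presented_axiom cong_scaleAr.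
Qed.

Definition subalgebra (S : set presented) : Prop :=
  [/\ S 1,
      forall (a : K) x y, S x -> S y -> S (a *: x + y)
    & forall x y, S x -> S y -> S (x * y)].

Definition generated_subalgebra (G : set presented) : set presented :=
  smallest subalgebra G.

End Presentation.

(* Indices run over 'I_n = {0, ..., n-1} instead of {1, ..., n}.  The         *)
(* product of 'S_n composes from left to right, (s * r)%g j = r (s j),        *)
(* whereas the action s xi_j = xi_(s j) s requires products of group elements *)
(* in the algebra to compose from right to left.                              *)

Section OddDAHA.

Variables (K : comPzRingType) (n : nat) (t u : K).

Inductive odd_gen : Type := GXi of 'I_n | GEta of 'I_n | GPerm of 'S_n.

Local Notation xi i := (EGen (GXi i)).
Local Notation eta i := (EGen (GEta i)).
Local Notation sg s := (EGen (GPerm s)).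

Inductive odd_rel : expr K odd_gen -> expr K odd_gen -> Prop :=
| odd_perm1 : odd_rel (sg 1%g) 1
| odd_permM (s r : 'S_n) : odd_rel (sg s * sg r) (sg (r * s)%g)
| odd_eta (i j : 'I_n) : i != j -> odd_rel (eta i * eta j) (- (eta j * eta i))
| odd_xi (i j : 'I_n) : i != j -> odd_rel (xi i * xi j) (- (xi j * xi i))
| odd_perm_xi (s : 'S_n) (j : 'I_n) : odd_rel (sg s * xi j) (xi (s j) * sg s)
| odd_perm_eta (s : 'S_n) (j : 'I_n) : odd_rel (sg s * eta j) (eta (s j) * sg s)
| odd_eta_xi (i j : 'I_n) : i != j ->
    odd_rel (eta i * xi j + xi j * eta i) (u *: sg (tperm i j))
| odd_eta_xi_diag (i : 'I_n) :
    odd_rel (eta i * xi i + xi i * eta i)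
            (t *: 1 + u *: \sum_(k | k != i) sg (tperm k i)).

Definition odd_daha := presented odd_rel.

Definition odd_daha_xi (i : 'I_n) : odd_daha := pgen odd_rel (GXi i).
Definition odd_daha_eta (i : 'I_n) : odd_daha := pgen odd_rel (GEta i).
Definition odd_daha_perm (s : 'S_n) : odd_daha := pgen odd_rel (GPerm s).

Definition odd_daha_z (i : 'I_n) : odd_daha :=
  (- (odd_daha_xi i * odd_daha_eta i)
   + u *: \sum_(k : 'I_n | (k < i)%N) odd_daha_perm (tperm k i))%R.

End OddDAHA.

Section DegenerateAHA.

Variables (K : comPzRingType) (n : nat) (u : K).

Inductive deg_gen : Type := GZ of 'I_n | GS of 'S_n.

Local Notation z i := (EGen (GZ i)).
Local Notation sg s := (EGen (GS s)).

(* Simple transpositions are tperm i j with j = i + 1.                        *)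
Inductive deg_rel : expr K deg_gen -> expr K deg_gen -> Prop :=
| deg_perm1 : deg_rel (sg 1%g) 1
| deg_permM (s r : 'S_n) : deg_rel (sg s * sg r) (sg (r * s)%g)
| deg_zC (i j : 'I_n) : deg_rel (z i * z j) (z j * z i)
| deg_perm_z (i j : 'I_n) : j = i.+1 :> nat ->
    deg_rel (sg (tperm i j) * z i) (z j * sg (tperm i j) - u *: 1)
| deg_perm_z_far (i j k : 'I_n) : j = i.+1 :> nat -> k != i -> k != j ->
    deg_rel (sg (tperm i j) * z k) (z k * sg (tperm i j)).

Definition deg_aha := presented deg_rel.

Definition deg_aha_z (i : 'I_n) : deg_aha := pgen deg_rel (GZ i).
Definition deg_aha_perm (s : 'S_n) : deg_aha := pgen deg_rel (GS s).

End DegenerateAHA.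

(* Main.v *)
From HB Require Import structures.
Require Import Defs.
From mathcomp Require Import all_boot all_order all_algebra fingroup perm.
From mathcomp Require Import boolp classical_sets functions reals complex.
From mathcomp Require Import zify.

Set Implicit Arguments.
Unset Strict Implicit.
Unset Printing Implicit Defensive.

Import GRing.Theory.
Local Open Scope ring_scope.
Local Open Scope quotient_scope.

Local Notation repr := generic_quotient.repr.

(** The map phi from the degenerate affine Hecke algebra exists because the
    elements z_i satisfy its relations.  Put y_i = - xi_i eta_i and let
    jm_i = sum_(k < i) s_ki be the Jucys-Murphy elements, so that
    z_i = y_i + u jm_i.  The y_i are permuted by S_n ([odd_sg_y]) and
    [y_i, y_j] = - u (y_i - y_j) s_ij ([odd_y_commutator]); for any such family
    the commutator of z_i and z_j vanishes, since the cross terms contribute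
    exactly + u (y_i - y_j) s_ij ([shift_commutator]).  Conversely, the elements
    y_i = z_i - u jm_i of the degenerate algebra N have both properties
    ([deg_sg_y], [deg_y_commutator]).

    For injectivity, without any PBW basis, it is enough to find a module M over the
    odd double affine Hecke algebra, a map ev : M -> N with
    ev (phi x . f) = x (ev f), and a vector f with ev f = 1: then
    phi x1 = phi x2 gives x1 = ev (phi x1 . f) = ev (phi x2 . f) = x2.

    The module M is coinduced from N after the eta_i have been made invertible.
    Its elements are the functions f from words in the letters eta_j^(+1),
    eta_j^(-1) to N that respect the relations between these letters
    ([admissible]).  Letters act by shifting, S_n acts on letters and values, and
    ev f is the value at the empty word.  The operator xi_i is forced: at the
    empty word xi_i = - y_i eta_i^(-1) prescribes it, and the relation
    eta_j xi_i = [eta_j, xi_i]_+ - xi_i eta_j propagates it along a word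
    ([xi_op]).  Two facts then have to be proved, each by induction on words: xi_i
    preserves admissible functions ([admissible_xi_op]), and the xi_i
    anticommute ([xi_op_anticomm]).  Both rest on the single identity
    [bracket_exchange], valid for any family of operators permuted by S_n, applied
    once to the eta_j and once to the xi_j; the start of the second induction is
    the commutator of the y_i.  Finally, products of anticommuting
    matrices with square 1 ([clifford_matrices]) give a scalar function with value
    1 at the empty word that respects all relations between the letters. *)

(** * Representations of presented algebras *)

Section ExprAct.

Variables (K : comPzRingType) (X : Type) (V : lmodType K).
Variable g : X -> V -> V.

Fixpoint expr_act (e : expr K X) (v : V) : V :=
  match e with
  | EGen x => g x v
  | EZero => 0
  | EOne => v
  | EOpp e1 => - expr_act e1 v
  | EAdd e1 e2 => expr_act e1 v + expr_act e2 v
  | EMul e1 e2 => expr_act e1 (expr_act e2 v)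
  | EScale a e1 => a *: expr_act e1 v
  end.

Lemma expr_act_sum (I : finType) (P : pred I) (F : I -> expr K X) v :
  expr_act (\big[@EAdd K X/EZero]_(i | P i) F i) v =
  \sum_(i | P i) expr_act (F i) v.
Proof. exact: (big_morph (expr_act^~ v)). Qed.

Hypothesis g_linear : forall x, linear (g x).

Lemma expr_act_linear e : linear (expr_act e).
Proof.
elim: e => [x|||e IHe|e1 IH1 e2 IH2|e1 IH1 e2 IH2|b e IHe] a v w //=.
- exact: g_linear.
- by rewrite scaler0 addr0.
- by rewrite IHe opprD scalerN.
- by rewrite IH1 IH2 scalerDr addrACA.
- by rewrite IH2 IH1.
- by rewrite IHe scalerDr !scalerA mulrC.
Qed.

Lemma expr_actD e : {morph expr_act e : v w / v + w}.
Proof. by move=> v w; have := expr_act_linear e 1 v w; rewrite !scale1r. Qed.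

Lemma expr_act0 e : expr_act e 0 = 0.
Proof. by apply: (addrI (expr_act e 0)); rewrite -expr_actD !addr0. Qed.

Lemma expr_actZ e a v : expr_act e (a *: v) = a *: expr_act e v.
Proof. by rewrite -[a *: v]addr0 expr_act_linear expr_act0 addr0. Qed.

(* The relations are only required to hold on a stable subspace S, so that no
   separate module structure on S has to be built.                          *)
Variables (E : expr K X -> expr K X -> Prop) (S : V -> Prop).
Hypothesis S0 : S 0.
Hypothesis S_linear : forall a v w, S v -> S w -> S (a *: v + w).
Hypothesis S_g : forall x v, S v -> S (g x v).

Lemma expr_act_stable e v : S v -> S (expr_act e v).
Proof.
have SD w1 w2 : S w1 -> S w2 -> S (w1 + w2).
  by move=> S1 S2; rewrite -[w1]scale1r; exact: S_linear.
have SZ a w : S w -> S (a *: w).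
  by move=> Sw; rewrite -[_ *: _]addr0; exact: S_linear.
elim: e v => [x|||e IHe|e1 IH1 e2 IH2|e1 IH1 e2 IH2|b e IHe] v Sv //=.
- exact: S_g.
- by rewrite -scaleN1r; apply: SZ; exact: IHe.
- by apply: SD; [exact: IH1|exact: IH2].
- by apply: IH1; exact: IH2.
- by apply: SZ; exact: IHe.
Qed.

Hypothesis act_rel :
  forall e e', E e e' -> forall v, S v -> expr_act e v = expr_act e' v.

Lemma expr_act_cong e e' :
  expr_cong E e e' -> forall v, S v -> expr_act e v = expr_act e' v.
Proof.
elim=> //= {e e'}.
- by move=> x y _ IH v Sv; rewrite IH.
- by move=> y x z _ IH1 _ IH2 v Sv; rewrite IH1 ?IH2.
- by move=> x y _ IH v Sv; rewrite IH.
- by move=> x x' y y' _ IH1 _ IH2 v Sv; rewrite IH1 ?IH2.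
- by move=> x x' y y' _ IH1 _ IH2 v Sv; rewrite IH1 ?IH2 //; exact: expr_act_stable.
- by move=> a x x' _ IH v Sv; rewrite IH.
- by move=> x y z v Sv; rewrite addrA.
- by move=> x y v Sv; rewrite addrC.
- by move=> x v Sv; rewrite add0r.
- by move=> x v Sv; rewrite addNr.
- by move=> x y z v Sv; rewrite expr_actD.
- by move=> a b x v Sv; rewrite scalerA.
- by move=> x v Sv; rewrite scale1r.
- by move=> a x y v Sv; rewrite scalerDr.
- by move=> a b x v Sv; rewrite scalerDl.
- by move=> a x y v Sv; rewrite expr_actZ.
Qed.

Definition presented_act (h : presented E) (v : V) : V := expr_act (repr h) v.

Lemma presented_act_pclass e v : S v -> presented_act (pclass E e) v = expr_act e v.
Proof. by apply: expr_act_cong; exact: repr_pclass. Qed.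

End ExprAct.

(** * Computing in presented algebras *)

Section PresentedTheory.

Variables (K : comPzRingType) (X : Type) (E : expr K X -> expr K X -> Prop).

Lemma pclass0 : pclass E 0%expr = 0. Proof. by []. Qed.
Lemma pclass1 : pclass E 1%expr = 1. Proof. by []. Qed.
Lemma pclassN x : pclass E (- x)%expr = - pclass E x.
Proof. exact: esym (pclass_opp E x). Qed.
Lemma pclassD x y : pclass E (x + y)%expr = pclass E x + pclass E y.
Proof. exact: esym (pclass_add E x y). Qed.
Lemma pclassM x y : pclass E (x * y)%expr = pclass E x * pclass E y.
Proof. exact: esym (pclass_mul E x y). Qed.
Lemma pclassZ a x : pclass E (a *: x)%expr = a *: pclass E x.
Proof. exact: esym (pclass_scale E a x). Qed.
Lemma pclass_sum (I : finType) (P : pred I) (F : I -> expr K X) :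
  pclass E (\big[@EAdd K X/EZero]_(i | P i) F i) = \sum_(i | P i) pclass E (F i).
Proof. exact: (big_morph (pclass E) pclassD pclass0). Qed.

Lemma pclass_rel x y : E x y -> pclass E x = pclass E y.
Proof. by move=> Exy; apply/pclassP/cong_rel. Qed.

Definition pclass_morphE :=
  (pclass0, pclass1, pclassN, pclassD, pclassM, pclassZ, pclass_sum).

Lemma scale_central (a : K) (x : presented E) : a *: x = (a *: (1 : presented E)) * x.
Proof. by rewrite -presented_scalerAl mul1r. Qed.

Lemma scale1_comm (a : K) (x : presented E) : GRing.comm (a *: (1 : presented E)) x.
Proof.
by rewrite /GRing.comm -presented_scalerAl -presented_scalerAr mul1r mulr1.
Qed.

End PresentedTheory.

(** * Homomorphisms between presented algebras *)

Section PresentedHom.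

Variables (K : comPzRingType) (X Y : Type).
Variables (E : expr K X -> expr K X -> Prop) (F : expr K Y -> expr K Y -> Prop).
Variable h : X -> presented F.

(** Evaluation is the action on the left regular representation, applied to 1;
    this makes the soundness of evaluation a case of [expr_act_cong]. *)
Definition expr_eval (e : expr K X) : presented F :=
  expr_act (fun x v => h x * v) e 1.

Let left_mul_linear x : linear (fun v : presented F => h x * v).
Proof. by move=> a v w /=; rewrite mulrDr -presented_scalerAr. Qed.

Lemma expr_act_left_mul e v : expr_act (fun x v => h x * v) e v = expr_eval e * v.
Proof.
rewrite /expr_eval.
elim: e v => [x|||e IHe|e1 IH1 e2 IH2|e1 IH1 e2 IH2|b e IHe] v /=.
- by rewrite mulr1.
- by rewrite mul0r.
- by rewrite mul1r.
- by rewrite IHe mulNr.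
- by rewrite IH1 IH2 mulrDl.
- by rewrite IH1 (IH2 v) (IH1 (_ _ e2 1)) mulrA.
- by rewrite IHe presented_scalerAl.
Qed.

Lemma expr_eval_mul e1 e2 : expr_eval (e1 * e2)%expr = expr_eval e1 * expr_eval e2.
Proof. by rewrite /expr_eval /= expr_act_left_mul. Qed.

Lemma expr_eval_gen x : expr_eval (EGen x) = h x.
Proof. by rewrite /expr_eval /= mulr1. Qed.

Hypothesis eval_rel : forall e e', E e e' -> expr_eval e = expr_eval e'.

Lemma presented_lift :
  exists phi : {rmorphism presented E -> presented F},
    scalable phi /\ (forall x, phi (pgen E x) = h x).
Proof.
pose f (x : presented E) := expr_eval (repr x).
have f_pclass e : f (pclass E e) = expr_eval e.
  rewrite /f /expr_eval.
  apply: (@expr_act_cong _ _ _ _ left_mul_linear E (fun=> True)) => //.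
    by move=> e1 e2 /eval_rel E12 v _; rewrite !expr_act_left_mul E12.
  exact: repr_pclass.
have fB : zmod_morphism f.
  move=> x y; elim/presented_ind: x => x; elim/presented_ind: y => y.
  by rewrite -pclassN -pclassD !f_pclass.
have fM : monoid_morphism f.
  split; first by rewrite -pclass1 f_pclass.
  move=> x y; elim/presented_ind: x => x; elim/presented_ind: y => y.
  by rewrite -pclassM !f_pclass expr_eval_mul.
pose fA := GRing.isZmodMorphism.Build _ _ f fB.
pose fMM := GRing.isMonoidMorphism.Build _ _ f fM.
pose phi : {rmorphism presented E -> presented F} := HB.pack f fA fMM.
exists phi; split.
  move=> a x; elim/presented_ind: x => x.
  by rewrite -pclassZ /= !f_pclass.
by move=> x /=; rewrite f_pclass expr_eval_gen.
Qed.

End PresentedHom.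

(** * Jucys-Murphy elements *)

(** Every permutation is a product of transpositions, and conjugating by the
    adjacent transposition (j - 1, j) moves the endpoint of one from j - 1 to j. *)
Lemma perm_adjacent_ind n (P : 'S_n -> Prop) :
  P 1%g -> (forall s r, P s -> P r -> P (s * r)%g) ->
  (forall i j : 'I_n, j = i.+1 :> nat -> P (tperm i j)) -> forall s, P s.
Proof.
move=> P1 PM Padj.
have Plt d (i j : 'I_n) : j = (i + d.+1)%N :> nat -> P (tperm i j).
  elim: d j => [|d IHd] j def_j; first by apply: Padj; rewrite def_j addn1.
  have lt_k : (i + d.+1 < n)%N.
    by rewrite (leq_trans _ (ltn_ord j)) // def_j ltnS leq_add2l.
  pose k := Ordinal lt_k.
  have kj : j = k.+1 :> nat by rewrite def_j addnS.
  have ik : i != k by rewrite -val_eqE /= neq_ltn -addSnnS ltnS leq_addr.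
  have ij : i != j by rewrite -val_eqE /= def_j neq_ltn -addSnnS ltnS leq_addr.
  suff -> : tperm i j = (tperm k j * tperm i k * tperm k j)%g.
    by apply: (PM); [apply: PM; [exact: Padj|exact: IHd]|exact: Padj].
  have -> : (tperm k j * tperm i k * tperm k j)%g = (tperm i k ^ tperm k j)%g.
    by rewrite conjgE tpermV mulgA.
  by rewrite tpermJ tpermL tpermD // eq_sym.
have Pt (i j : 'I_n) : P (tperm i j).
  case: (ltngtP i j) => [ij|ji|/val_inj ->]; last by rewrite tperm1.
    by apply: (Plt (j - i.+1)%N); rewrite addnS -addSn subnKC.
  by rewrite tpermC; apply: (Plt (i - j.+1)%N); rewrite addnS -addSn subnKC.
move=> s; have [ts -> _] := prod_tpermP s.
by elim/big_rec: _ => // t r _ Pr; apply: PM.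
Qed.

Section JucysMurphy.

Variables (n : nat) (A : pzRingType) (sg : 'S_n -> A).
Hypotheses (sg1 : sg 1%g = 1) (sgM : forall s r, sg s * sg r = sg (r * s)%g).

Definition jucys_murphy (i : 'I_n) : A := \sum_(k : 'I_n | (k < i)%N) sg (tperm k i).

Local Notation jm := jucys_murphy.

Lemma sg_tpermK i j : sg (tperm i j) * sg (tperm i j) = 1.
Proof. by rewrite sgM tperm2. Qed.

Lemma sg_tperm s i j : sg s * sg (tperm i j) = sg (tperm (s i) (s j)) * sg s.
Proof. by rewrite !sgM -tpermJ conjgC. Qed.

Lemma sg_jm s i :
  sg s * jm i = (\sum_(k : 'I_n | (k < i)%N) sg (tperm (s k) (s i))) * sg s.
Proof.
by rewrite mulr_sumr mulr_suml; apply: eq_bigr => k _; exact: sg_tperm.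
Qed.

(** Conjugation by s only permutes the summands of jm_i. *)
Lemma sg_jm_comm (s : 'S_n) (i : 'I_n) :
  s i = i -> (forall k : 'I_n, (s k < i)%N = (k < i)%N) ->
  GRing.comm (sg s) (jm i).
Proof.
move=> si slt; rewrite /GRing.comm sg_jm si; congr (_ * _).
rewrite /jm [RHS](reindex_inj (@perm_inj _ s)) /=.
by apply: eq_bigl => k; rewrite slt.
Qed.

(** Conjugation turns the sum over k < i of s_ki into that of s_kj, which lacks
    the summand s_ij of jm_j; that summand cancels the outer s_ij. *)
Lemma sg_jm_adjacent (i j : 'I_n) : j = i.+1 :> nat ->
  sg (tperm i j) * jm i = jm j * sg (tperm i j) - 1.
Proof.
move=> ij; rewrite sg_jm tpermL /jm [in RHS](bigD1 i) /=; last by rewrite ij.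
rewrite mulrDl sg_tpermK [1 + _]addrC addrK; congr (_ * _).
rewrite [RHS](eq_bigl (fun k : 'I_n => k < i)%N); last first.
  by move=> k; rewrite ij ltnS leq_eqVlt -val_eqE /=; case: ltngtP.
apply: eq_bigr => k ki; rewrite tpermD // -val_eqE /= neq_ltn ?ki ?orbT //.
by rewrite ij (leqW ki) ?orbT.
Qed.

Lemma tperm_lt (i j k l : 'I_n) : (i < k)%N = (j < k)%N -> (tperm i j l < k)%N = (l < k)%N.
Proof. by case: tpermP => [->|->|]. Qed.

Lemma sg_jm_far (i j k : 'I_n) : j = i.+1 :> nat -> k != i -> k != j ->
  GRing.comm (sg (tperm i j)) (jm k).
Proof.
move=> ij ki kj; apply: sg_jm_comm; first by rewrite tpermD // eq_sym.
by move=> l; apply: tperm_lt; move: ki kj; rewrite -!val_eqE /= ij; lia.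
Qed.

Lemma jm_comm i j : GRing.comm (jm i) (jm j).
Proof.
suff lt_comm (a b : 'I_n) : (a < b)%N -> GRing.comm (jm a) (jm b).
  case: (ltngtP i j) => [|ji|/val_inj ->] //; first exact: lt_comm.
  exact/commr_sym/lt_comm.
move=> ab; apply/commr_sym/commr_sum => k ka; apply/commr_sym/sg_jm_comm.
  rewrite tpermD // -val_eqE /= neq_ltn; first by rewrite (ltn_trans ka ab).
  by rewrite ab.
by move=> l; apply: tperm_lt; rewrite ab (ltn_trans ka ab).
Qed.

(* U stands for the scalar u, seen as a central element of A. *)
Variables (U : A) (y : 'I_n -> A).
Hypothesis U_central : forall x, GRing.comm U x.

Section Shift.

Hypothesis sg_y : forall s i, sg s * y i = y (s i) * sg s.

Definition jm_shift i : A := y i + U * jm i.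
Local Notation z := jm_shift.

Lemma sg_shift_adjacent (i j : 'I_n) : j = i.+1 :> nat ->
  sg (tperm i j) * z i = z j * sg (tperm i j) - U.
Proof.
move=> ij; rewrite mulrDr sg_y tpermL mulrA -U_central -mulrA sg_jm_adjacent //.
by rewrite mulrBr mulr1 mulrDl mulrA addrA.
Qed.

Lemma sg_shift_far (i j k : 'I_n) : j = i.+1 :> nat -> k != i -> k != j ->
  GRing.comm (sg (tperm i j)) (z k).
Proof.
move=> ij ki kj; apply: commrD.
  by rewrite /GRing.comm sg_y tpermD // eq_sym.
by apply: commrM; [exact/commr_sym|exact: sg_jm_far].
Qed.

Lemma y_jm_comm (i j : 'I_n) : (i < j)%N -> GRing.comm (y j) (jm i).
Proof.
move=> ij; apply: commr_sum => k ki; apply/commr_sym; rewrite /GRing.comm sg_y.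
by rewrite tpermD // -val_eqE /= neq_ltn ?ij // (ltn_trans ki ij).
Qed.

(** The only summand of jm_j that moves y_i is s_ij. *)
Lemma y_jm_commutator (i j : 'I_n) : (i < j)%N ->
  y i * jm j - jm j * y i = (y i - y j) * sg (tperm i j).
Proof.
move=> ij; rewrite /jm (bigD1 i) //= mulrDr mulrDl opprD addrACA.
rewrite sg_y tpermL -mulrBl [X in _ + X](_ : _ = 0) ?addr0 //.
apply/eqP; rewrite subr_eq0; apply/eqP.
apply: commr_sum => k /andP[kj ki]; apply/commr_sym; rewrite /GRing.comm sg_y.
by rewrite tpermD // eq_sym -val_eqE /= neq_ltn ij.
Qed.

(** This identity serves twice: in the odd algebra the right-hand side is known
    to vanish and the z_i are seen to commute; in the degenerate algebra the z_i
    commute and the commutators of the y_i are read off. *)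
Lemma shift_commutator (i j : 'I_n) : (i < j)%N ->
  z i * z j - z j * z i =
  y i * y j - y j * y i + U * ((y i - y j) * sg (tperm i j)).
Proof.
move=> ij; rewrite -y_jm_commutator //.
have pC : GRing.comm (U * jm i) (y j + U * jm j).
  apply/commr_sym/commrM; first exact/commr_sym.
  apply/commr_sym/commrD; first exact/commr_sym/y_jm_comm.
  by apply: commrM; [exact/commr_sym|exact: jm_comm].
rewrite /jm_shift; set w := y j + _ in pC *.
rewrite [_ * w]mulrDl [w * _]mulrDr pC opprD addrACA subrr addr0.
rewrite mulrDr mulrDl opprD addrACA; congr (_ + _).
by rewrite mulrBr !mulrA (U_central (y i)).
Qed.

End Shift.

End JucysMurphy.

(** * The degenerate affine Hecke algebra *)

Section DegenerateTheory.

Variables (K : comPzRingType) (n : nat) (u : K).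

Local Notation N := (deg_aha n u).
Local Notation sg := (@deg_aha_perm K n u).
Local Notation z := (@deg_aha_z K n u).
Local Notation U := (u *: (1 : N)).
Local Notation jm := (jucys_murphy sg).

Lemma deg_sg1 : sg 1%g = 1.
Proof. exact: (pclass_rel (deg_perm1 n u)). Qed.

Lemma deg_sgM s r : sg s * sg r = sg (r * s)%g.
Proof. by rewrite -[LHS]pclassM; exact: (pclass_rel (deg_permM u s r)). Qed.

Lemma deg_zC i j : z i * z j = z j * z i.
Proof. by rewrite -[LHS]pclassM -[RHS]pclassM; exact: (pclass_rel (deg_zC u i j)). Qed.

Lemma deg_sg_z (i j : 'I_n) : j = i.+1 :> nat ->
  sg (tperm i j) * z i = z j * sg (tperm i j) - U.
Proof.
move=> ij; rewrite -[LHS]pclassM (pclass_rel (deg_perm_z u ij)).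
by rewrite !pclass_morphE.
Qed.

Lemma deg_sg_z_far (i j k : 'I_n) : j = i.+1 :> nat -> k != i -> k != j ->
  sg (tperm i j) * z k = z k * sg (tperm i j).
Proof.
move=> ij ki kj; rewrite -[LHS]pclassM (pclass_rel (deg_perm_z_far u ij ki kj)).
by rewrite !pclass_morphE.
Qed.

Definition deg_y (i : 'I_n) : N := z i - U * jm i.

Lemma deg_yK i : jm_shift sg U deg_y i = z i.
Proof. exact: subrK. Qed.

(** Subtracting the Jucys-Murphy elements absorbs the correction term - u in the
    cross relations. *)
Lemma deg_sg_y s i : sg s * deg_y i = deg_y (s i) * sg s.
Proof.
elim/perm_adjacent_ind: s i => [i|s r IHs IHr i|i j ij k].
- by rewrite deg_sg1 mulr1 mul1r perm1.
- by rewrite -deg_sgM -mulrA IHs mulrA IHr -mulrA permM.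
have adj : sg (tperm i j) * deg_y i = deg_y j * sg (tperm i j).
  rewrite mulrBr deg_sg_z // mulrA -(scale1_comm u) -mulrA.
  rewrite (sg_jm_adjacent deg_sg1 deg_sgM ij) mulrBr mulr1 mulrA mulrBl.
  by rewrite opprB addrA subrK.
case: tpermP => [->//|->|/eqP ki /eqP kj].
  have sK := sg_tpermK deg_sg1 deg_sgM i j.
  rewrite -[deg_y j]mulr1 -sK [deg_y j * _]mulrA -adj !mulrA.
  by rewrite sK mul1r.
rewrite mulrBr mulrBl deg_sg_z_far //; congr (_ - _).
by apply: commrM; [exact/commr_sym/scale1_comm|exact: (sg_jm_far deg_sgM)].
Qed.

Lemma deg_y_commutator i j : i != j ->
  deg_y i * deg_y j + U * (deg_y i * sg (tperm i j)) =
  deg_y j * deg_y i + U * (deg_y j * sg (tperm i j)).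
Proof.
suff lt_case (a b : 'I_n) : (a < b)%N ->
    deg_y a * deg_y b + U * (deg_y a * sg (tperm a b)) =
    deg_y b * deg_y a + U * (deg_y b * sg (tperm a b)).
  rewrite -val_eqE neq_ltn => /orP[/lt_case //|/lt_case].
  by rewrite tpermC => ->.
move=> ab.
have := shift_commutator deg_sgM (@scale1_comm _ _ _ u) deg_sg_y ab.
rewrite !deg_yK deg_zC subrr (mulrBl (sg _) (deg_y a)) (mulrBr U).
rewrite addrACA -opprD => /esym/eqP.
by rewrite subr_eq0 => /eqP.
Qed.

End DegenerateTheory.

(** * Relations between the z_i in the odd double affine Hecke algebra *)

Section OddTheory.

Variables (K : comPzRingType) (n : nat) (t u : K).

Local Notation H := (odd_daha n t u).
Local Notation sg := (@odd_daha_perm K n t u).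
Local Notation xi := (@odd_daha_xi K n t u).
Local Notation eta := (@odd_daha_eta K n t u).
Local Notation z := (@odd_daha_z K n t u).
Local Notation U := (u *: (1 : H)).
Local Notation jm := (jucys_murphy sg).

Lemma odd_sg1 : sg 1%g = 1.
Proof. exact: (pclass_rel (Defs.odd_perm1 n t u)). Qed.

Lemma odd_sgM s r : sg s * sg r = sg (r * s)%g.
Proof. by rewrite -[LHS]pclassM; exact: (pclass_rel (Defs.odd_permM t u s r)). Qed.

Lemma odd_etaC i j : i != j -> eta i * eta j = - (eta j * eta i).
Proof.
move=> ij; rewrite -[LHS]pclassM (pclass_rel (odd_eta t u ij)).
by rewrite !pclass_morphE.
Qed.

Lemma odd_xiC i j : i != j -> xi i * xi j = - (xi j * xi i).
Proof.
move=> ij; rewrite -[LHS]pclassM (pclass_rel (odd_xi t u ij)).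
by rewrite !pclass_morphE.
Qed.

Lemma odd_sg_xi s j : sg s * xi j = xi (s j) * sg s.
Proof.
rewrite -[LHS]pclassM (pclass_rel (odd_perm_xi t u s j)).
by rewrite !pclass_morphE.
Qed.

Lemma odd_sg_eta s j : sg s * eta j = eta (s j) * sg s.
Proof.
rewrite -[LHS]pclassM (pclass_rel (odd_perm_eta t u s j)).
by rewrite !pclass_morphE.
Qed.

Lemma odd_etaxi i j : i != j ->
  eta i * xi j = U * sg (tperm i j) - xi j * eta i.
Proof.
move=> ij; apply/eqP; rewrite -subr_eq opprK; apply/eqP.
have := pclass_rel (odd_eta_xi t u ij).
by rewrite !pclass_morphE scale_central.
Qed.

Definition odd_y (i : 'I_n) : H := - (xi i * eta i).

Lemma odd_daha_zE i : z i = jm_shift sg U odd_y i.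
Proof. by rewrite /odd_daha_z scale_central. Qed.

Lemma odd_sg_y s i : sg s * odd_y i = odd_y (s i) * sg s.
Proof.
by rewrite /odd_y mulrN mulNr mulrA odd_sg_xi -mulrA odd_sg_eta mulrA.
Qed.

(** Moving eta_i past xi_j in xi_i eta_i xi_j eta_j leaves the quartic term
    xi_i xi_j eta_i eta_j, symmetric in i and j because both pairs anticommute,
    and one term in s_ij. *)
Lemma odd_y_commutator i j : i != j ->
  odd_y i * odd_y j - odd_y j * odd_y i +
  U * ((odd_y i - odd_y j) * sg (tperm i j)) = 0.
Proof.
have expand a b : a != b -> odd_y a * odd_y b =
    - (U * (odd_y a * sg (tperm a b))) - xi a * xi b * (eta a * eta b).
  move=> ab; rewrite {1 2}/odd_y mulrNN -(mulrA (xi a) (eta a)).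
  rewrite (mulrA (eta a)) (odd_etaxi ab) mulrBl mulrBr; congr (_ - _).
    rewrite -mulrA odd_sg_eta tpermR mulrA -(scale1_comm u).
    by rewrite mulNr mulrN opprK !mulrA.
  by rewrite !mulrA.
move=> ij; have ji : j != i by rewrite eq_sym.
rewrite (expand i j) // (expand j i) // (odd_xiC ji) (odd_etaC ji) mulrNN.
rewrite [tperm j i]tpermC opprD addrACA subrr addr0 mulrBl mulrBr.
by rewrite !opprK [- _ + _]addrC -opprB addNr.
Qed.

Lemma odd_zC i j :
  z i * z j = z j * z i.
Proof.
suff lt_case (a b : 'I_n) : (a < b)%N ->
    z a * z b = z b * z a.
  by case: (ltngtP i j) => [/lt_case //|/lt_case //|/val_inj ->].
move=> ab; rewrite !odd_daha_zE; apply/eqP; rewrite -subr_eq0.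
rewrite (shift_commutator odd_sgM (@scale1_comm _ _ _ u) odd_sg_y ab).
by rewrite odd_y_commutator // -val_eqE /= neq_ltn ab.
Qed.

Definition deg_to_odd_gen (x : deg_gen n) : H :=
  match x with GZ i => z i | GS s => sg s end.

Lemma deg_to_odd_rel e e' : @deg_rel K n u e e' ->
  expr_eval deg_to_odd_gen e = expr_eval deg_to_odd_gen e'.
Proof.
have zE i : expr_eval deg_to_odd_gen (EGen (GZ i)) = z i.
  exact: expr_eval_gen.
have sE s : expr_eval deg_to_odd_gen (EGen (GS s)) = sg s.
  exact: expr_eval_gen.
case=> {e e'}.
- by rewrite sE odd_sg1.
- by move=> s r; rewrite expr_eval_mul !sE odd_sgM.
- by move=> i j; rewrite !expr_eval_mul !zE odd_zC.
- move=> i j ij; rewrite expr_eval_mul sE zE odd_daha_zE.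
  rewrite (sg_shift_adjacent odd_sg1 odd_sgM (@scale1_comm _ _ _ u) odd_sg_y ij).
  by rewrite -odd_daha_zE -zE -sE -expr_eval_mul.
- move=> i j k ij ki kj; rewrite !expr_eval_mul sE zE odd_daha_zE.
  exact: (sg_shift_far odd_sgM (@scale1_comm _ _ _ u) odd_sg_y ij ki kj).
Qed.

Lemma deg_to_odd : exists phi : {rmorphism deg_aha n u -> H},
  [/\ scalable phi, forall i, phi (deg_aha_z u i) = z i
    & forall s, phi (deg_aha_perm u s) = sg s].
Proof.
have [phi [phiZ phi_gen]] := presented_lift deg_to_odd_rel.
by exists phi; split=> // x; exact: phi_gen.
Qed.

End OddTheory.

(** * A module coinduced from the degenerate algebra *)

Section LaurentModule.

Variables (K : comPzRingType) (n : nat) (t u : K).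

Local Notation N := (deg_aha n u).
Local Notation sg := (@deg_aha_perm K n u).
Local Notation y := (@deg_y K n u).

(** The letter (j, true) stands for eta_j and (j, false) for its inverse. *)
Definition letter : Type := ('I_n * bool)%type.
Definition word_fun : Type := seq letter -> N.
HB.instance Definition _ := GRing.Lmodule.on word_fun.

Definition shift (a : letter) (f : word_fun) : word_fun := fun w => f (a :: w).

Definition shifts (w : seq letter) (f : word_fun) : word_fun := fun w' => f (w ++ w').

Definition letter_act (s : 'S_n) (a : letter) : letter := (s a.1, a.2).

Definition perm_op (s : 'S_n) (f : word_fun) : word_fun :=
  fun w => sg s * f (map (letter_act s^-1) w).

(** The operator by which the anticommutator of eta_i and xi_j has to act. *)
Definition bracket (i j : 'I_n) (f : word_fun) : word_fun :=
  if i == j then t *: f + u *: \sum_(k | k != i) perm_op (tperm k i) f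
  else u *: perm_op (tperm i j) f.

(** The anticommutator of a letter with xi_i: for an inverse letter it follows from
    [eta^(-1), xi]_+ = eta^(-1) [eta, xi]_+ eta^(-1). *)
Definition letter_bracket (i : 'I_n) (a : letter) (f : word_fun) : word_fun :=
  if a.2 then bracket a.1 i f else shift a (bracket a.1 i (shift a f)).

(** At the empty word xi_i = (xi_i eta_i) eta_i^(-1) = - y_i eta_i^(-1), and along
    a word xi_i is moved past the first letter. *)
Fixpoint xi_op (i : 'I_n) (f : word_fun) (w : seq letter) {struct w} : N :=
  match w with
  | [::] => - (y i * f [:: (i, false)])
  | a :: w' => letter_bracket i a f w' - xi_op i (shift a f) w'
  end.

Arguments shift : simpl never.
Arguments shifts : simpl never.
Arguments perm_op : simpl never.
Arguments bracket : simpl never.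
Arguments letter_bracket : simpl never.
Arguments xi_op : simpl never.

Lemma shift_linear a : linear (shift a). Proof. by []. Qed.
HB.instance Definition _ a :=
  GRing.isLinear.Build K word_fun word_fun *:%R (shift a) (shift_linear a).

Lemma shifts_linear w : linear (shifts w). Proof. by []. Qed.
HB.instance Definition _ w :=
  GRing.isLinear.Build K word_fun word_fun *:%R (shifts w) (shifts_linear w).

Lemma perm_op_linear s : linear (perm_op s).
Proof.
move=> a f g; apply/funext => w.
by rewrite /perm_op !fctE mulrDr presented_scalerAr.
Qed.
HB.instance Definition _ s :=
  GRing.isLinear.Build K word_fun word_fun *:%R (perm_op s) (perm_op_linear s).

Lemma bracket_linear i j : linear (bracket i j).
Proof.
move=> a f g; rewrite /bracket; case: eqP => _; last first.
  by rewrite linearP scalerDr !scalerA mulrC.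
under eq_bigr do rewrite linearP.
rewrite big_split /= -scaler_sumr !scalerDr !scalerA (mulrC a t) (mulrC a u).
by rewrite addrACA.
Qed.
HB.instance Definition _ i j :=
  GRing.isLinear.Build K word_fun word_fun *:%R (bracket i j) (bracket_linear i j).

Lemma letter_bracket_linear i a : linear (letter_bracket i a).
Proof.
by move=> b f g; rewrite /letter_bracket; case: ifP => _; rewrite !linearP.
Qed.
HB.instance Definition _ i a :=
  GRing.isLinear.Build K word_fun word_fun *:%R (letter_bracket i a)
    (letter_bracket_linear i a).

Lemma xi_op_linear i : linear (xi_op i : word_fun -> word_fun).
Proof.
move=> b f g; apply/funext => w; elim: w f g => [|a w IHw] f g;
  rewrite {1}/xi_op -/xi_op.
  by rewrite !fctE mulrDr opprD -presented_scalerAr scalerN.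
rewrite [shift a _]linearP /= IHw [letter_bracket i a _]linearP /= !fctE /=.
by rewrite opprD scalerBr addrACA.
Qed.
HB.instance Definition _ i :=
  GRing.isLinear.Build K word_fun word_fun *:%R (xi_op i) (xi_op_linear i).

Lemma shift_xi_op a i f :
  shift a (xi_op i f) = letter_bracket i a f - xi_op i (shift a f).
Proof. by []. Qed.

Lemma shiftN a f : shift a (- f) = - shift a f.
Proof. by []. Qed.

Lemma shiftD a f g : shift a (f + g) = shift a f + shift a g.
Proof. by []. Qed.

Lemma shift_xi_pos j i f :
  shift (j, true) (xi_op i f) = bracket j i f - xi_op i (shift (j, true) f).
Proof. by []. Qed.

Lemma shift_xi_neg j i f :
  shift (j, false) (xi_op i f) =
  shift (j, false) (bracket j i (shift (j, false) f)) -
  xi_op i (shift (j, false) f).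
Proof. by []. Qed.

Lemma letter_actK s : cancel (letter_act s) (letter_act s^-1).
Proof. by case=> i b; rewrite /letter_act /= permK. Qed.

Lemma letter_actKV s : cancel (letter_act s^-1) (letter_act s).
Proof. by case=> i b; rewrite /letter_act /= permKV. Qed.

Lemma perm_op1 f : perm_op 1%g f = f.
Proof.
apply/funext => w; rewrite /perm_op deg_sg1 mul1r; congr f.
by rewrite map_id_in // => -[i b] _; rewrite /letter_act /= invg1 perm1.
Qed.

Lemma perm_opM s r f : perm_op s (perm_op r f) = perm_op (r * s)%g f.
Proof.
apply/funext => w; rewrite /perm_op mulrA deg_sgM -map_comp invMg.
congr (_ * f _); apply: eq_map => -[i b].
by rewrite /letter_act /= permM.
Qed.

Lemma perm_op_tperm s i j f :
  perm_op s (perm_op (tperm i j) f) = perm_op (tperm (s i) (s j)) (perm_op s f).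
Proof. by rewrite !perm_opM -tpermJ conjgC. Qed.

Lemma perm_op_shift s a f :
  perm_op s (shift a f) = shift (letter_act s a) (perm_op s f).
Proof. by apply/funext => w; rewrite /shift /perm_op /= letter_actK. Qed.

Lemma shift_perm_op s a f :
  shift a (perm_op s f) = perm_op s (shift (letter_act s^-1 a) f).
Proof. by rewrite perm_op_shift letter_actKV. Qed.

Lemma shifts_perm_op s w f :
  shifts w (perm_op s f) = perm_op s (shifts (map (letter_act s^-1) w) f).
Proof. by apply/funext => w'; rewrite /shifts /perm_op map_cat. Qed.

Lemma bracketC i j f : bracket i j f = bracket j i f.
Proof. by rewrite /bracket eq_sym; case: eqP => [->//|_]; rewrite tpermC. Qed.

Lemma perm_op_bracket s i j f :
  perm_op s (bracket i j f) = bracket (s i) (s j) (perm_op s f).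
Proof.
rewrite /bracket (inj_eq perm_inj); case: eqP => [_|_]; last first.
  by rewrite linearZ /= perm_op_tperm.
rewrite linearD !linearZ linear_sum /=; congr (_ + _ *: _).
rewrite [RHS](reindex_inj (@perm_inj _ s)) /=.
by apply: eq_big => k; rewrite ?(inj_eq perm_inj) // => _; rewrite perm_op_tperm.
Qed.

Lemma perm_op_letter_bracket s i a f :
  perm_op s (letter_bracket i a f) =
  letter_bracket (s i) (letter_act s a) (perm_op s f).
Proof.
rewrite /letter_bracket /=; case: ifP => _; first exact: perm_op_bracket.
by rewrite perm_op_shift perm_op_bracket perm_op_shift.
Qed.

Lemma perm_op_xi_op s i f : perm_op s (xi_op i f) = xi_op (s i) (perm_op s f).
Proof.
apply/funext => w; elim: w f => [|a w IHw] f.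
  rewrite /perm_op /xi_op /= mulrN !mulrA deg_sg_y; congr (- (_ * f [:: _])).
  by rewrite /letter_act /= permK.
rewrite -[LHS]/(shift a _ w) shift_perm_op shift_xi_op linearB /=.
rewrite perm_op_letter_bracket letter_actKV !fctE IHw.
by rewrite perm_op_shift letter_actKV.
Qed.

(** Both consistency checks of the construction reduce to this identity: with X the
    shifts by eta it says that xi is compatible with eta_j eta_k = - eta_k eta_j,
    and with X the operators xi_op that the anticommutators of the xi_i commute
    with the eta_k.  Only the transposition (a, b) in [eta_a, X_a]_+ exchanges X_a
    and X_b, and it is compensated by the mixed bracket u s_ab. *)
Lemma bracket_exchange (X : 'I_n -> {linear word_fun -> word_fun}) i j k f :
    (forall s l g, perm_op s (X l g) = X (s l) (perm_op s g)) -> i != j ->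
  bracket k i (X j f) + bracket k j (X i f) =
  X j (bracket k i f) + X i (bracket k j f).
Proof.
move=> Xs ij.
have diag a b : a != b -> bracket a a (X b f) + bracket a b (X a f) =
    X b (bracket a a f) + X a (bracket a b f).
  move=> ab; rewrite /bracket eqxx (negPf ab).
  have ba : b != a by rewrite eq_sym.
  rewrite (bigD1 b) //= [in RHS](bigD1 b) //= !Xs !tpermL (tpermC b a).
  rewrite (linearD (X b)) !linearZ (linearD (X b)) (linear_sum (X b)) /=.
  rewrite -!addrA -!scalerDr; congr (_ + _ *: _).
  rewrite addrAC [RHS]addrAC [X in _ = X + _]addrC; congr (_ + _).
  by apply: eq_bigr => k0 /andP[k0a k0b]; rewrite Xs tpermD.
have [->|ki] := eqVneq k i; first exact: diag.
have [->|kj] := eqVneq k j; first by rewrite addrC [RHS]addrC diag // eq_sym.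
rewrite /bracket (negPf ki) (negPf kj) !linearZ /= !Xs.
by rewrite !tpermD // eq_sym.
Qed.

(** Anticommutation is only imposed on the positive letters; for inverse letters it
    follows by cancellation ([shift_neg_anticomm]). *)
Definition local_rel (f : word_fun) : Prop :=
  (forall j k, j != k ->
     shift (k, true) (shift (j, true) f) = - shift (j, true) (shift (k, true) f))
  /\ (forall j b, shift (j, ~~ b) (shift (j, b) f) = f).

(** Relations at every position of a word are relations at the head of a
    shifted function. *)
Definition admissible (f : word_fun) : Prop := forall w, local_rel (shifts w f).

Lemma local_rel_linear a f g :
  local_rel f -> local_rel g -> local_rel (a *: f + g).
Proof.
move=> [fC fK] [gC gK]; split=> [j k jk|j b]; rewrite !linearP /=.
  by rewrite fC // gC // scalerN opprD.
by rewrite fK gK.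
Qed.

Lemma admissible_linear a f g :
  admissible f -> admissible g -> admissible (a *: f + g).
Proof.
by move=> Sf Sg w; rewrite linearP; apply: local_rel_linear; [exact: Sf|exact: Sg].
Qed.

Lemma admissible0 : admissible 0.
Proof. by move=> w; split=> [j k jk|j b]; rewrite !linear0 ?oppr0. Qed.

Lemma admissibleZ a f : admissible f -> admissible (a *: f).
Proof.
by move=> Sf; rewrite -[_ *: _]addr0; apply: admissible_linear => //; exact: admissible0.
Qed.

Lemma admissibleD f g : admissible f -> admissible g -> admissible (f + g).
Proof. by move=> Sf Sg; rewrite -[f]scale1r; exact: admissible_linear. Qed.

Lemma admissible_local f : admissible f -> local_rel f.
Proof. by move/(_ [::]). Qed.

Lemma admissible_shift a f : admissible f -> admissible (shift a f).
Proof. by move=> Sf w; exact: (Sf (a :: w)). Qed.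

Lemma admissible_perm_op s f : admissible f -> admissible (perm_op s f).
Proof.
move=> Sf w; rewrite shifts_perm_op; have [fC fK] := Sf (map (letter_act s^-1) w).
split=> [j k jk|j b]; rewrite !shift_perm_op.
  by rewrite fC ?linearN // (inj_eq perm_inj).
by rewrite fK.
Qed.

Lemma admissible_bracket i j f : admissible f -> admissible (bracket i j f).
Proof.
move=> Sf; rewrite /bracket; case: eqP => _; last exact/admissibleZ/admissible_perm_op.
apply: admissible_linear => //; apply: admissibleZ.
elim/big_ind: _ => // [||k _]; [exact: admissible0|exact: admissibleD|].
exact: admissible_perm_op.
Qed.

Lemma admissible_letter_bracket i a f :
  admissible f -> admissible (letter_bracket i a f).
Proof.
move=> Sf; rewrite /letter_bracket; case: ifP => _; first exact: admissible_bracket.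
exact/admissible_shift/admissible_bracket/admissible_shift.
Qed.

(** Moving xi_i past two letters produces the rearranged letters, taken care of by
    the relations of f, and bracket terms that cancel by [bracket_exchange]. *)
Lemma xi_op_local i f : admissible f -> local_rel (xi_op i f).
Proof.
move=> Sf; have [fC fK] := admissible_local Sf; split=> [j k jk|j b].
  rewrite !shift_xi_pos !(linearB (shift _)) /= !shift_xi_pos fC //.
  have := @bracket_exchange (fun l => shift (l, true)) j k i f.
  move=> /(_ (fun s l g => perm_op_shift s (l, true) g) jk) /=.
  rewrite ![bracket i _ _]bracketC (linearN (xi_op i)) /= opprK.
  set P := shift _ (bracket j i f); set Q := bracket k i (shift _ f).
  set R := shift _ (bracket k i f); set S := bracket j i (shift _ f) => ex.
  have -> : P = S - R + Q.
    by apply/eqP; rewrite addrAC eq_sym subr_eq; apply/eqP.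
  by rewrite opprD addrA addrK opprB addrAC.
case: b; rewrite ?shift_xi_pos ?shift_xi_neg !(linearB (shift _)) /=.
  by rewrite shift_xi_neg (fK j true) opprB addrC subrK.
rewrite shift_xi_pos (fK j false).
set g := bracket j i _.
have [_ /(_ j false) -> ] : local_rel g.
  exact/admissible_local/admissible_bracket/admissible_shift.
by rewrite opprB addrC subrK.
Qed.

Lemma admissible_xi_op i f : admissible f -> admissible (xi_op i f).
Proof.
move=> Sf w; elim: w f Sf => [|a w IHw] f Sf; first exact: xi_op_local.
rewrite -[shifts _ _]/(shifts w (shift a (xi_op i f))) shift_xi_op linearB /=.
rewrite addrC -scaleN1r; apply: local_rel_linear;
  last exact: (admissible_letter_bracket i a Sf w).
exact/IHw/admissible_shift.
Qed.

(** Writing f = eta_j eta_i h with h = eta_i^(-1) eta_j^(-1) f, the relation of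
    eta_i and eta_j applied to h gives that of the inverses applied to f. *)
Lemma shift_neg_anticomm i j f : admissible f -> i != j ->
  shift (j, false) (shift (i, false) f) = - shift (i, false) (shift (j, false) f).
Proof.
move=> Sf ij; set h := shift (i, false) (shift (j, false) f).
have [_ fK] := admissible_local Sf.
have Sj := admissible_shift (j, false) Sf.
have Sh : admissible h by exact: admissible_shift.
have [hC hK] := admissible_local Sh.
have [_ jK] := admissible_local Sj.
have fE : shift (j, true) (shift (i, true) h) = f.
  by rewrite (jK i false) (fK j false).
rewrite -[in LHS]fE hC // !shiftN; congr (- _).
have [_ /(_ i true) ->] := admissible_local (admissible_shift (j, true) Sh).
exact: (hK j true).
Qed.

Definition xi_anticomm (i j : 'I_n) (f : word_fun) : word_fun :=
  xi_op i (xi_op j f) + xi_op j (xi_op i f).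

Lemma shift_pos_xi_anticomm k i j f : i != j ->
  shift (k, true) (xi_anticomm i j f) = xi_anticomm i j (shift (k, true) f).
Proof.
move=> ij; rewrite /xi_anticomm shiftD !shift_xi_pos.
rewrite (linearB (xi_op i)) (linearB (xi_op j)) /= !opprB addrACA.
rewrite (bracket_exchange _ _ perm_op_xi_op ij) [X in _ + X]addrACA addrCA.
by rewrite -opprD [X in - X]addrC subrr addr0.
Qed.

(** The anticommutator of xi_i and xi_j commutes with every letter, so it vanishes
    once its value at the empty word does; there, two inverse letters come out and
    the value is the commutator relation of y_i and y_j in N, applied to
    f (eta_i^(-1) eta_j^(-1)). *)
Lemma xi_op_anticomm i j f : admissible f -> i != j ->
  xi_op i (xi_op j f) = - xi_op j (xi_op i f).
Proof.
move=> Sf ij; apply/eqP; rewrite -addr_eq0; apply/eqP.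
suff vanish w g : admissible g -> xi_anticomm i j g w = 0.
  by apply/funext => w; exact: vanish.
have SE h : admissible h -> admissible (xi_anticomm i j h).
  by move=> Sh; apply: admissibleD; do 2?[apply: admissible_xi_op].
elim: w g => [|[k b] w IHw] g Sg.
  have base a c : a != c -> xi_op a (xi_op c g) [::] =
      - (y a * (u *: (sg (tperm a c) * g [:: (a, false); (c, false)])
                + y c * g [:: (a, false); (c, false)])).
    move=> ac; rewrite {1}/xi_op -/xi_op; congr (- (_ * _)).
    rewrite -[LHS]/(shift (a, false) (xi_op c g) [::]) shift_xi_neg.
    rewrite /bracket (negPf ac) !fctE; congr (_ + _); last exact: opprK.
    by rewrite /shift /perm_op /= /letter_act /= tpermV tpermL.
  have ji : j != i by rewrite eq_sym.
  rewrite /xi_anticomm fctE !base // [tperm j i]tpermC.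
  have -> : g [:: (j, false); (i, false)] = - g [:: (i, false); (j, false)].
    have := shift_neg_anticomm Sg ij => /(congr1 (fun h => h [::])).
    by rewrite !fctE /shift => ->; rewrite opprK.
  set F := g _; set s := sg _.
  have assoc a c : y a * (u *: (s * F) + y c * F) =
      (y a * y c + (u *: (1 : N)) * (y a * s)) * F.
    by rewrite mulrDr -presented_scalerAr scale_central (mulrDl (y a * y c)) !mulrA
      addrC.
  rewrite !mulrN scalerN -(opprD (u *: _)) mulrN opprK !assoc.
  by rewrite (deg_y_commutator u ij) addNr.
(* An inverse letter commutes with the anticommutator because its inverse does. *)
rewrite -[LHS]/(shift (k, b) (xi_anticomm i j g) w).
case: b; first by rewrite shift_pos_xi_anticomm // IHw //; exact: admissible_shift.
have [_ gK] := admissible_local Sg.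
have Sk := admissible_shift (k, false) Sg.
have [_ EK] := admissible_local (SE _ Sk).
by rewrite -[g in xi_anticomm _ _ g](gK k false) -shift_pos_xi_anticomm //
  (EK k true) IHw.
Qed.

Definition odd_act_gen (x : odd_gen n) : word_fun -> word_fun :=
  match x with
  | GXi i => xi_op i
  | GEta i => shift (i, true)
  | GPerm s => perm_op s
  end.

Lemma odd_act_gen_linear x : linear (odd_act_gen x).
Proof. by case: x => [i|i|s]; apply: linearP. Qed.

Lemma admissible_odd_act_gen x f : admissible f -> admissible (odd_act_gen x f).
Proof.
case: x => [i|i|s]; [exact: admissible_xi_op|exact: admissible_shift|].
exact: admissible_perm_op.
Qed.

Lemma odd_act_rel e e' : odd_rel t u e e' -> forall f, admissible f ->
  expr_act odd_act_gen e f = expr_act odd_act_gen e' f.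
Proof.
case=> {e e'} /=.
- by move=> f _; rewrite perm_op1.
- by move=> s r f _; rewrite perm_opM.
- move=> i j ij f Sf; have [fC _] := admissible_local Sf.
  by rewrite fC // eq_sym.
- by move=> i j ij f Sf; rewrite xi_op_anticomm.
- by move=> s j f _; rewrite perm_op_xi_op.
- by move=> s j f _; rewrite perm_op_shift.
- by move=> i j ij f _; rewrite shift_xi_pos subrK /bracket (negPf ij).
- by move=> i f _; rewrite shift_xi_pos subrK /bracket eqxx expr_act_sum.
Qed.

Lemma odd_act_pclass e f : admissible f ->
  presented_act odd_act_gen (pclass (odd_rel t u) e) f = expr_act odd_act_gen e f.
Proof.
apply: presented_act_pclass.
- exact: odd_act_gen_linear.
- exact: admissible0.
- exact: admissible_linear.
- exact: admissible_odd_act_gen.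
- exact: odd_act_rel.
Qed.

End LaurentModule.

(** * Evaluation at the empty word and injectivity *)

(** Induction step: c_i becomes diag(c_i, - c_i), and the new matrix swaps the two
    blocks. *)
Lemma clifford_matrices (K : comPzRingType) n :
  exists m (c : 'I_n -> 'M[K]_m.+1),
    (forall i, c i * c i = 1) /\
    (forall i j, i != j -> c i * c j = - (c j * c i)).
Proof.
elim: n => [|n [m [c [cK cC]]]].
  by exists 0%N, (fun=> 1); split=> -[].
pose B (i : 'I_n.+1) : 'M[K]_(m.+1 + m.+1) :=
  if unlift ord0 i is Some j then block_mx (c j) 0 0 (- c j)
  else block_mx 0 1%:M 1%:M 0.
have BK i : B i *m B i = 1%:M.
  rewrite scalar_mx_block /B; case: unliftP => [j _|_].
    rewrite mulmx_block !(mulmx0, mul0mx, addr0, add0r) mulmxN mulNmx opprK.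
    by rewrite -[c j *m c j]/(c j * c j) cK.
  by rewrite mulmx_block !(mulmx0, mul0mx, addr0, add0r) !mul1mx.
have BC i j : i != j -> B i *m B j = - (B j *m B i).
  rewrite /B; case: unliftP => [i' ->|->]; case: unliftP => [j' ->|->] ij;
    rewrite !mulmx_block !(mulmx0, mul0mx, addr0, add0r) opp_block_mx ?oppr0.
  - rewrite !mulmxN !mulNmx !opprK; move: ij; rewrite (inj_eq lift_inj) => /cC.
    by rewrite -[c i' * c j']/(c i' *m c j') -[c j' * c i']/(c j' *m c i') => ->.
  - by rewrite !(mulmx1, mul1mx) opprK.
  - by rewrite !(mulmx1, mul1mx) opprK.
  - by rewrite eqxx in ij.
by exists (m + m.+1)%N, B.
Qed.

Section Injectivity.

Variables (K : comPzRingType) (n : nat) (t u : K).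

Local Notation N := (deg_aha n u).
Local Notation V := (word_fun n u).

(** Take for f the matrix coefficient at (0, 0) of the product of the Clifford
    matrices along a word, a letter and its inverse giving the same matrix. *)
Lemma admissible_unit : exists f : V, admissible f /\ f [::] = 1.
Proof.
have [m [c [cK cC]]] := clifford_matrices K n.
pose F (M : 'M[K]_m.+1) : V :=
  fun w => (foldl (fun P a => P * c a.1) M w) 0 0 *: (1 : N).
have shiftF a M : shift a (F M) = F (M * c a.1) by [].
have FN M : F (- M) = - F M.
  apply/funext => w; rewrite fctE /F -scaleNr; congr (_ *: _).
  by elim: w M => [|a w IHw] M /=; rewrite ?mxE // mulNr IHw.
have shiftsF w M : exists P, shifts w (F M) = F P.
  elim: w M => [|a w IHw] M; first by exists M.
  by have [P FP] := IHw (M * c a.1); exists P; exact: FP.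
exists (F 1); split; last by rewrite /F /= mxE eqxx scale1r.
move=> w; have [P ->] := shiftsF w 1; split=> [j k jk|j b]; rewrite !shiftF /=.
  by rewrite -!mulrA cC // mulrN FN.
by rewrite -mulrA cK mulr1.
Qed.

(** Evaluation at the empty word intertwines the action through phi with left
    multiplication.  The generators z_i are the point: xi_i eta_i acts on the value
    at the empty word as - y_i, because eta_i and its inverse cancel. *)
Lemma deg_to_odd_regular (phi : {rmorphism deg_aha n u -> odd_daha n t u}) :
    scalable phi ->
    (forall i, phi (deg_aha_z u i) = odd_daha_z t u i) ->
    (forall s, phi (deg_aha_perm u s) = odd_daha_perm t u s) ->
  forall x (f : V), admissible f ->
  presented_act (@odd_act_gen K n t u) (phi x) f [::] = x * f [::].
Proof.
move=> phiZ phi_z phi_s.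
pose act (h : odd_daha n t u) (f : V) : V := presented_act (@odd_act_gen K n t u) h f.
have actE e f : admissible f ->
    act (pclass (odd_rel t u) e) f = expr_act (@odd_act_gen K n t u) e f.
  exact: odd_act_pclass.
have act_stable h (f : V) : admissible f -> admissible (act h f).
  apply: expr_act_stable; [exact: admissible0|exact: admissible_linear|].
  exact: admissible_odd_act_gen.
have actN h (f : V) : admissible f -> act (- h) f = - act h f.
  by elim/presented_ind: h => e Sf; rewrite -pclassN !actE.
have actD h1 h2 (f : V) : admissible f -> act (h1 + h2) f = act h1 f + act h2 f.
  elim/presented_ind: h1 => e1; elim/presented_ind: h2 => e2 Sf.
  by rewrite -pclassD !actE.
have actM h1 h2 (f : V) : admissible f -> act (h1 * h2) f = act h1 (act h2 f).
  elim/presented_ind: h1 => e1; elim/presented_ind: h2 => e2 Sf.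
  rewrite -pclassM (actE e2) // !actE //.
  by rewrite -(actE e2) //; exact: act_stable.
have actZ a h (f : V) : admissible f -> act (a *: h) f = a *: act h f.
  by elim/presented_ind: h => e Sf; rewrite -pclassZ !actE.
have eval_sum (P : pred 'I_n) (G : 'I_n -> V) :
    (\sum_(k | P k) G k) [::] = \sum_(k | P k) G k [::].
  exact: (big_morph (fun h : V => h [::])).
move=> x f Sf; rewrite -[LHS]/(act (phi x) f [::]).
elim/presented_ind: x f Sf => e.
elim: e => [x|||e IHe|e1 IH1 e2 IH2|e1 IH1 e2 IH2|a e IHe] f Sf.
- case: x => [i|s]; last first.
    by rewrite -[pclass _ _]/(deg_aha_perm u s) phi_s actE.
  rewrite -[pclass _ _]/(deg_aha_z u i) phi_z.
  have -> : odd_daha_z t u i = pclass (odd_rel t u)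
      (- (EGen (GXi i) * EGen (GEta i))
       + u *: \big[@EAdd _ _/EZero]_(k : 'I_n | (k < i)%N)
                EGen (GPerm (tperm k i)))%expr.
    by rewrite !pclass_morphE.
  have xi_eta : xi_op t i (shift (i, true) f) [::] = - (deg_y u i * f [::]).
    rewrite /xi_op; congr (- (_ * _)).
    by have [_ /(_ i true) /(congr1 (fun h => h [::]))] := admissible_local Sf.
  rewrite actE //= expr_act_sum !fctE xi_eta opprK.
  rewrite eval_sum.
  rewrite -(deg_yK u i) /jm_shift (mulrDl (deg_y u i)).
  by rewrite -scale_central -presented_scalerAl mulr_suml.
- by rewrite pclass0 rmorph0 -pclass0 actE //= mul0r.
- by rewrite pclass1 rmorph1 -pclass1 actE //= mul1r.
- by rewrite pclassN rmorphN actN // fctE IHe // mulNr.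
- by rewrite pclassD rmorphD actD // fctE IH1 // IH2 // mulrDl.
- by rewrite pclassM rmorphM actM // IH1 ?IH2 ?mulrA //; exact: act_stable.
- by rewrite pclassZ phiZ actZ // fctE IHe // presented_scalerAl.
Qed.

Lemma deg_to_odd_inj (phi : {rmorphism deg_aha n u -> odd_daha n t u}) :
    scalable phi ->
    (forall i, phi (deg_aha_z u i) = odd_daha_z t u i) ->
    (forall s, phi (deg_aha_perm u s) = odd_daha_perm t u s) ->
  injective phi.
Proof.
move=> phiZ phi_z phi_s x1 x2 eq_phi.
have [f [Sf f1]] := admissible_unit.
by rewrite -[x1]mulr1 -[x2]mulr1 -f1 -!(deg_to_odd_regular phiZ) // eq_phi.
Qed.

End Injectivity.

Lemma range_presented_hom (K : comPzRingType) (X Y : Type)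
    (E : expr K X -> expr K X -> Prop) (F : expr K Y -> expr K Y -> Prop)
    (phi : {rmorphism presented E -> presented F}) (G : set (presented F)) :
    scalable phi -> (forall x, G (phi (pgen E x))) -> (G `<=` range phi)%classic ->
  range phi = generated_subalgebra G.
Proof.
move=> phiZ phiG Gphi; apply/seteqP; split; last first.
  apply: smallest_sub => //; split.
  - by exists 1 => //; rewrite rmorph1.
  - move=> a _ _ [x _ <-] [y _ <-]; exists (a *: x + y) => //.
    by rewrite rmorphD phiZ.
  - by move=> _ _ [x _ <-] [y _ <-]; exists (x * y) => //; rewrite rmorphM.
move=> _ [x _ <-] A [[A1 Alin AM] GA].
have A0 : A 0 by rewrite -(addNr 1) -scaleN1r; exact: Alin.
have AZ a y : A y -> A (a *: y) by move=> Ay; rewrite -[_ *: _]addr0; exact: Alin.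
elim/presented_ind: x; elim=> [x|||e IHe|e1 IH1 e2 IH2|e1 IH1 e2 IH2|a e IHe].
- exact/GA/phiG.
- by rewrite pclass0 rmorph0.
- by rewrite pclass1 rmorph1.
- by rewrite pclassN rmorphN -scaleN1r; exact: AZ.
- by rewrite pclassD rmorphD -[phi _]scale1r; exact: Alin.
- by rewrite pclassM rmorphM; exact: AM.
- by rewrite pclassZ phiZ; exact: AZ.
Qed.

Local Open Scope classical_set_scope.

Theorem proposition5p18 (R : realType) (n : nat) (n_gt0 : (0 < n)%N)
    (t u : R[i]) :
  exists phi : {rmorphism deg_aha n u -> odd_daha n t u},
    [/\ scalable phi,
        forall i : 'I_n, phi (deg_aha_z u i) = odd_daha_z t u i,
        forall s : 'S_n, phi (deg_aha_perm u s) = odd_daha_perm t u s,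
        injective phi
      & range phi =
        generated_subalgebra
          (range (@odd_daha_z _ n t u) `|` range (@odd_daha_perm _ n t u))].
Proof.
have [phi [phiZ phi_z phi_s]] := deg_to_odd n t u.
exists phi; split=> //; first exact: (deg_to_odd_inj phiZ phi_z phi_s).
apply: range_presented_hom => // [[i|s]|_ [[i _ <-]|[s _ <-]]].
- by left; exists i => //; rewrite -phi_z.
- by right; exists s => //; rewrite -phi_s.
- by exists (deg_aha_z u i).
- by exists (deg_aha_perm u s).
Qed.
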